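(* Let $n\ge1$ be an integer and suppose $\alpha_1=\alpha_2=\dots=n$. Then $\mathfrak H(\mathbf B_\alpha)=\log n$.
   Context: Let $\mu_j>0$ ($j\in\mathbb N_0=\{0,1,\dots\}$) with $\sum_j\mu_j=1$. For an integer $m\ge1$ let $\mathbf E_m$ be the $m\times m$ matrix all of whose entries equal $1/m$. For a non-decreasing sequence of positive integers $\alpha=(\alpha_k)_{k\ge1}$ let $\mathbf B_\alpha=\mathrm{diag}(\mathbf E_{\alpha_1},\mathbf E_{\alpha_2},\dots)$ be the block-diagonal operator on $l^1(\mathbb N_0)$. For an infinite matrix $\mathbf B=(\mathbf B_{jk})_{j,k\in\mathbb N_0}$ with nonnegative entries and all row and column sums at most $1$, let $\mathbf B_J=(\mathbf B_{jk})_{0\le j,k<J}$ and let $\mathcal P_J$ be the projection of $\mathbb C^J$ onto $\mathrm{Ker}(\mathbf B_J-I)$ along $\mathrm{Im}(\mathbf B_J-I)$ (these are complementary). With $e=(1,\dots,1)$, $\mu^{(J)}=(\mu_0,\dots,\mu_{J-1})$, $0\log0=0$, put $$\mathfrak h(\mathbf B_J)=-\sum_{j,k=0}^{J-1}(\mathcal P_J^Te)_j(\mathbf B_J)_{jk}(\mathcal P_J\mu^{(J)})_k\log(\mathbf B_J)_{jk},\qquad \mathfrak H(\mathbf B)=\lim_{J\to\infty}\mathfrak h(\mathbf B_J).$$ *)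

(* Defs.v *)
From HB Require Import structures.
From mathcomp Require Import all_boot all_order all_algebra.
From mathcomp Require Export complex.
From mathcomp Require Import all_classical all_reals all_analysis.

Set Implicit Arguments.
Unset Strict Implicit.
Unset Printing Implicit Defensive.

Import Order.TTheory GRing.Theory Num.Theory.
Import numFieldNormedType.Exports.

Local Open Scope classical_set_scope.
Local Open Scope ring_scope.
Local Open Scope complex_scope.

(* Block sizes are indexed from 0: [alpha k] is the size of the (k+1)-st block.
   [block_index alpha j] is the least k such that j < alpha 0 + ... + alpha k,
   i.e. the block containing j; searching k <= j suffices when all the block
   sizes are positive. *)
Definition block_index (alpha : nat -> nat) (j : nat) : nat :=
  find (fun k => j < \sum_(i < k.+1) alpha i)%N (iota 0 j.+1).

Lemma block_indexP (alpha : nat -> nat) (j : nat) :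
  (forall k, 0 < alpha k)%N ->
  (\sum_(i < block_index alpha j) alpha i <= j
     < \sum_(i < (block_index alpha j).+1) alpha i)%N.
Proof.
move=> alpha_gt0; rewrite /block_index.
set p := fun k => (j < \sum_(i < k.+1) alpha i)%N.
have hasp : has p (iota 0 j.+1).
  apply/hasP; exists j; first by rewrite mem_iota add0n ltnSn.
  rewrite /p -[X in (X <= _)%N]card_ord -sum1_card.
  by apply: leq_sum => i _; exact: alpha_gt0.
have ltk : (find p (iota 0 j.+1) < j.+1)%N.
  by rewrite -[X in (_ < X)%N](size_iota 0) -has_find.
have := nth_find 0%N hasp; rewrite nth_iota // add0n => pk.
rewrite [X in _ && X]pk andbT.
case Ek: (find p (iota 0 j.+1)) => [|k]; first by rewrite big_ord0.
have := @before_find _ 0%N p (iota 0 j.+1) k; rewrite Ek ltnSn => /(_ isT).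
rewrite nth_iota ?add0n; last by rewrite ltnW // -Ek.
by rewrite /p ltnNge => /negbFE.
Qed.

(* diag(E_(alpha 0), E_(alpha 1), ...), where all the entries of E_m are 1/m. *)
Definition Balpha {R : realType} (alpha : nat -> nat) (j k : nat) : R :=
  if block_index alpha j == block_index alpha k
  then ((alpha (block_index alpha j))%:R)^-1 else 0.

Definition truncmx {R : realType} (B : nat -> nat -> R) (J : nat) : 'M[R]_J :=
  \matrix_(j < J, k < J) B j k.

(* The projection of C^J (column vectors) onto Ker(M - I) along Im(M - I).
   [kermx] and [proj_mx] use row vectors, acted on from the right, hence the
   transpositions. *)
Definition ker_proj {R : realType} {J : nat} (M : 'M[R[i]]_J) : 'M[R[i]]_J :=
  (proj_mx (kermx (M - 1%:M)^T) (M - 1%:M)^T)^T.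

Lemma ker_projP {R : realType} {J : nat} (M : 'M[R[i]]_J) (v w : 'cV[R[i]]_J) :
  (kermx (M - 1%:M)^T :&: (M - 1%:M)^T = 0)%MS ->
  M *m v = v -> ker_proj M *m (v + (M - 1%:M) *m w) = v.
Proof.
move=> dx Mv; rewrite /ker_proj mulmxDr.
apply: trmx_inj; rewrite linearD /= !trmx_mul !trmxK.
rewrite proj_mx_id ?proj_mx_0 ?addr0 ?submxMl //.
by apply/sub_kermxP; rewrite -trmx_mul mulmxBl mul1mx Mv subrr trmx0.
Qed.

(* The convention 0 log 0 = 0 holds because of the factor [M j k]. *)
Definition frakh {R : realType} {J : nat} (mu : nat -> R) (M : 'M[R]_J) : R[i] :=
  let MC : 'M[R[i]]_J := map_mx (real_complex R) M in
  let e : 'cV[R[i]]_J := const_mx 1 in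
  let muJ : 'cV[R[i]]_J := \col_k (mu k)%:C in
  - \sum_(j < J) \sum_(k < J)
      ((ker_proj MC)^T *m e) j 0 * (M j k)%:C * (ker_proj MC *m muJ) k 0
        * (ln (M j k))%:C.

(* [R[i]^o] is the complex field with the topology of its modulus. *)
Definition frakh_seq {R : realType} (mu : nat -> R) (B : nat -> nat -> R)
  : nat -> R[i]^o := fun J => frakh mu (truncmx B J).

Definition frakH {R : realType} (mu : nat -> R) (B : nat -> nat -> R) : R[i]^o :=
  limn (frakh_seq mu B).

(* Main.v *)
(** Since [E_n] is idempotent and a truncated block [F] of size [r < n] satisfies
    [F^2 = (r/n) F], hence has no eigenvalue 1, the projection [P_J] is [E_n] on
    the complete blocks of [B_J] and 0 on the incomplete one.  As every nonzero
    entry of [B_J] is [1/n], the sum [h(B_J)] is [log n * e^T P_J B_J P_J mu],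
    which is [log n] times the mass of the complete blocks, and this mass tends
    to 1. *)
Require Import Defs.
From HB Require Import structures.
From mathcomp Require Import all_boot all_order all_algebra.
From mathcomp Require Import all_classical all_reals all_analysis.
From mathcomp Require Import zify ring.

Set Implicit Arguments.
Unset Strict Implicit.
Unset Printing Implicit Defensive.

Import Order.TTheory GRing.Theory Num.Theory.
Import numFieldNormedType.Exports.

Local Open Scope classical_set_scope.
Local Open Scope ring_scope.
Local Open Scope complex_scope.

Lemma block_index_const (alpha : nat -> nat) (n j : nat) :
  (0 < n)%N -> (forall k, alpha k = n) -> block_index alpha j = (j %/ n)%N.
Proof.
move=> n_gt0 alphaE.
have sumE m : (\sum_(i < m) alpha i = m * n)%N.
  by rewrite (eq_bigr (fun=> n)) ?sum_nat_const ?card_ord.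
have := @block_indexP alpha j; rewrite !sumE => /(_ _)/andP[|lo hi].
  by move=> k; rewrite alphaE.
by apply/eqP; rewrite eqn_leq leq_divRL// lo -ltnS ltn_divLR.
Qed.

(** Subtraction in [nat] stops at 0, so the formula also covers blocks that start at or beyond
    [J]. *)
Lemma sum_divn_eq (n J b : nat) : (0 < n)%N ->
  (\sum_(k < J) (k %/ n == b) = minn n (J - b * n))%N.
Proof.
move=> n_gt0; elim: J => [|J IH]; first by rewrite big_ord0; lia.
rewrite big_ord_recr /= IH.
have -> : (J %/ n == b)%N = ((b * n <= J) && (J < b * n + n))%N.
  by rewrite eqn_leq -ltnS ltn_divLR// leq_divRL// mulSnr andbC.
lia.
Qed.

Section KerProj.
Variables (R : realType) (J : nat).
Implicit Types M P W : 'M[R[i]]_J.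

(** The first and third hypotheses split every [x] as [P x + (M - 1) W x], a kernel vector plus an
    image vector; the other two make this sum direct, as [ker_projP] requires. *)
Lemma ker_proj_unique M P W : M *m P = P -> P *m M = P ->
  1%:M - P = (M - 1%:M) *m W -> 1%:M - P = W *m (M - 1%:M) -> ker_proj M = P.
Proof.
move=> MP PM defr defl.
have dx : (kermx (M - 1%:M)^T :&: (M - 1%:M)^T = 0)%MS.
  (* Up to transposition, [v] lies in both the image of [M - 1], which [P] kills, and its kernel,
     which [1 - P] kills. *)
  apply/eqP/rowV0P => v; rewrite sub_capmx => /andP[/sub_kermxP vker /submxP[u vE]].
  have vP0 : v *m P^T = 0.
    by rewrite vE -mulmxA -trmx_mul mulmxBr PM mulmx1 subrr trmx0 mulmx0.
  have : v *m (1%:M - P)^T = 0 by rewrite defl trmx_mul mulmxA vker mul0mx.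
  by rewrite linearB /= trmx1 mulmxBr mulmx1 vP0 subr0.
have idE (x : 'cV_J) : ker_proj M *m x = P *m x.
  have {1}-> : x = P *m x + (M - 1%:M) *m (W *m x).
    by rewrite mulmxA -defr -mulmxDl addrC subrK mul1mx.
  by rewrite ker_projP// mulmxA MP.
apply/matrixP => i j.
have /matrixP/(_ i 0) := idE (col j 1%:M).
by rewrite !colE !mul1mx -!colE !mxE.
Qed.

End KerProj.

Section BlockMx.
Variables (F : numFieldType) (n J : nat).
Hypothesis n_gt0 : (0 < n)%N.
Implicit Types (b : nat) (c d : nat -> F).

(** The truncation to size [J] of [diag(c 0 E_n, c 1 E_n, ...)]. Such matrices are closed under
    products and include both [B_J] and its projection. *)
Definition blockmx c : 'M[F]_J :=
  \matrix_(j, k) ((j %/ n == k %/ n)%N%:R * c (j %/ n)%N / n%:R).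

Lemma eq_blockmx c d : c =1 d -> blockmx c = blockmx d.
Proof. by move=> cd; apply/matrixP => j k; rewrite !mxE cd. Qed.

(* The only possibly nonzero eigenvalue of block [b] of the truncated matrix. *)
Definition block_ratio b : F := (minn n (J - b * n))%:R / n%:R.

Lemma sum_block_ratio b : \sum_(k < J) (b == k %/ n)%N%:R / n%:R = block_ratio b.
Proof.
rewrite -mulr_suml -natr_sum /block_ratio -sum_divn_eq//; congr (_%:R / _).
by apply: eq_bigr => k _; rewrite eq_sym.
Qed.

Lemma block_ratio_eq1 b : (block_ratio b == 1) = (b < J %/ n)%N.
Proof.
have nF0 : n%:R != 0 :> F by rewrite pnatr_eq0 -lt0n.
rewrite /block_ratio -[X in _ == X](divff nF0) (inj_eq (mulIf _)) ?invr_eq0//.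
by rewrite eqr_nat leq_divRL// mulSnr; lia.
Qed.

(** A truncated block is a multiple of an all-ones matrix, whose square is itself times its size;
    this produces the factor [block_ratio b]. *)
Lemma mul_blockmx c d :
  blockmx c *m blockmx d = blockmx (fun b => c b * d b * block_ratio b).
Proof.
apply/matrixP => j l; rewrite !mxE -sum_block_ratio.
rewrite mulrCA -[RHS]mulrA mulr_sumr mulr_suml mulr_sumr; apply: eq_bigr => k _.
rewrite !mxE; case: (eqVneq (j %/ n) (k %/ n))%N => [->|_]; last by rewrite !(mulr0n, mul0r, mulr0).
by rewrite mulr1n; field; rewrite pnatr_eq0 -lt0n.
Qed.

Lemma blockmx_col_sum c d (k : 'I_J) :
  \sum_(j < J) c (j %/ n)%N * blockmx d j k =
  c (k %/ n)%N * d (k %/ n)%N * block_ratio (k %/ n).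
Proof.
rewrite -sum_block_ratio mulr_sumr; apply: eq_bigr => j _; rewrite mxE [in RHS]eq_sym.
by case: eqP => [->|_]; rewrite ?mul0r ?mulr0//; ring.
Qed.

End BlockMx.

Section EntropyConst.
Variables (R : realType) (n : nat) (alpha : nat -> nat).
Hypotheses (n_gt0 : (0 < n)%N) (alphaE : forall k, alpha k = n).

Lemma truncmx_Balpha (J : nat) :
  map_mx (real_complex R) (truncmx (Balpha alpha) J) = blockmx n J (fun=> 1).
Proof.
apply/matrixP => j k; rewrite !mxE /Balpha !(block_index_const _ n_gt0 alphaE).
rewrite alphaE; case: eqP => _; last by rewrite !mul0r.
by rewrite !mul1r fmorphV/= rmorph_nat.
Qed.

Lemma ker_proj_Balpha (J : nat) :
  ker_proj (map_mx (real_complex R) (truncmx (Balpha alpha) J)) =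
  blockmx n J (fun b => (b < J %/ n)%N%:R).
Proof.
rewrite truncmx_Balpha.
set w := @block_ratio R[i] n J.
have wE b : (b < J %/ n)%N%:R = (w b == 1)%:R :> R[i] by rewrite block_ratio_eq1.
(* [d b = 0] on the complete blocks, by the convention [0^-1 = 0]. *)
pose d b := (w b - 1)^-1.
have dE b : d b * w b = 1 - (b < J %/ n)%N%:R + d b.
  rewrite wE /d; case: eqVneq => [->|wb1]; first by rewrite !subrr invr0 mul0r addr0.
  by rewrite mulr0n; field; rewrite subr_eq0.
have defr : blockmx n J (fun b => 1 * d b * w b) =
    blockmx n J (fun=> 1) - blockmx n J (fun b => (b < J %/ n)%N%:R)
    + blockmx n J d.
  by apply/matrixP => j k; rewrite !mxE mul1r dE; ring.
(* With [M] for [B_J], [P] for the candidate projection and [D = blockmx n J d],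
   [(M - 1)(D - 1) = M D - M - D + 1]. This equals [1 - P] because [defr] says [M D = M - P + D],
   which is what the choice of [d] achieves. *)
apply: (@ker_proj_unique _ _ _ _ (blockmx n J d - 1%:M)).
- rewrite mul_blockmx//; apply: eq_blockmx => b.
  by rewrite mul1r -/w wE; case: eqP => [->|]; rewrite ?mulr1 ?mul0r.
- rewrite mul_blockmx//; apply: eq_blockmx => b.
  by rewrite mulr1 -/w wE; case: eqP => [->|]; rewrite ?mulr1 ?mul0r.
- rewrite mulmxBl mulmxBr mul_blockmx// defr mulmx1 mul1mx.
  by apply/matrixP => j k; rewrite !mxE; ring.
- rewrite mulmxBl mulmxBr mul_blockmx//.
  rewrite (@eq_blockmx _ _ _ (fun b => d b * 1 * w b) (fun b => 1 * d b * w b));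
    last by move=> b; rewrite mulr1 mul1r.
  rewrite defr mulmx1 mul1mx.
  by apply/matrixP => j k; rewrite !mxE; ring.
Qed.

Lemma frakh_Balpha (mu : nat -> R) (J : nat) :
  frakh mu (truncmx (Balpha alpha) J) =
  (ln (n%:R : R) * series mu (J %/ n * n)%N)%:C.
Proof.
pose full (b : nat) : bool := (b < J %/ n)%N.
have fullw b : (full b)%:R * block_ratio R[i] n J b = (full b)%:R.
  rewrite /full -(block_ratio_eq1 R[i])//.
  by case: eqP => [->|]; rewrite ?mulr1 ?mul0r.
(* The complete blocks occupy exactly the indices below [J %/ n * n]. *)
rewrite (_ : series mu _ = \sum_(l < J) (full (l %/ n)%N)%:R * mu l); last first.
  rewrite /series/= big_mkord (big_ord_widen J mu) ?leq_trunc_div//.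
  rewrite big_mkcond; apply: eq_bigr => l _.
  by rewrite /full ltn_divLR//; case: ifP; rewrite ?mul1r ?mul0r.
rewrite /frakh ker_proj_Balpha.
set P := blockmx _ _ _; set v := \col_k _.
have PTe j : (P^T *m (const_mx 1 : 'cV_J)) j 0 = (full (j %/ n)%N)%:R.
  have := blockmx_col_sum n_gt0 (fun=> 1) (fun b => (full b)%:R : R[i]) j.
  rewrite mul1r fullw => <-; rewrite mxE.
  by apply: eq_bigr => k _; rewrite !mxE mulr1 mul1r.
(* This covers the zero entries too: both sides vanish there. *)
have MlnM (j k : 'I_J) :
    (truncmx (Balpha alpha) J j k)%:C * (ln (truncmx (Balpha alpha) J j k))%:C =
    - (ln (n%:R : R))%:C * blockmx n J (fun=> 1) j k.
  rewrite -truncmx_Balpha !mxE /Balpha alphaE; case: ifP => _.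
    by rewrite lnV ?posrE ?ltr0n// rmorphN/= mulrC.
  by rewrite rmorph0 mul0r mulr0.
(* Summing over [j] first absorbs [B_J]: the indicator of the complete blocks is a left fixed vector
   of [B_J]. *)
transitivity ((ln (n%:R : R))%:C * \sum_(k < J) (full (k %/ n)%N)%:R * (P *m v) k 0).
  rewrite exchange_big/= mulr_sumr -sumrN; apply: eq_bigr => k _.
  have := blockmx_col_sum n_gt0 (fun b => (full b)%:R : R[i]) (fun=> 1) k.
  rewrite mulr1 fullw => <-.
  rewrite mulr_suml mulr_sumr -sumrN; apply: eq_bigr => j _.
  by rewrite PTe; ring: (MlnM j k).
rewrite rmorphM rmorph_sum; congr (_ * _).
(* The same indicator is also fixed by [P] from the left, so the sum over [k] collapses. *)
under eq_bigr do rewrite mxE mulr_sumr.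
rewrite exchange_big/=; apply: eq_bigr => l _.
under eq_bigr do rewrite mulrA.
rewrite -mulr_suml (blockmx_col_sum n_gt0 (fun b => (full b)%:R)).
by rewrite -mulrA !fullw -natrM mulnb andbb mxE rmorphM rmorph_nat.
Qed.

End EntropyConst.

Lemma cvg_real_complex (R : realType) (u : nat -> R) (l : R) :
  u @ \oo --> l -> (fun k => (u k)%:C : R[i]^o) @ \oo --> (l%:C : R[i]^o).
Proof.
move=> ul; apply/cvgrPdist_lt => e e_gt0.
(* The radius [e] is an element of [R[i]], and being positive there forces it to be real. *)
have /complex_realP[d dE] : e \is Num.real by exact: gtr0_real.
rewrite dE ltcR in e_gt0 *.
have /cvgrPdist_lt/(_ _ e_gt0) := ul.
apply: filterS => k; rewrite -ltcR -rmorphB.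
by rewrite normc_def/= expr0n addr0 sqrtr_sqr.
Qed.

Theorem lemma9p7 (R : realType) (mu : nat -> R)
  (mu_gt0 : forall j, 0 < mu j)
  (mu_sum1 : series mu @ \oo --> (1 : R))
  (n : nat) (n_ge1 : (1 <= n)%N)
  (alpha : nat -> nat) (alphaE : forall k, alpha k = n) :
  cvgn (frakh_seq mu (Balpha alpha)) /\
  frakH mu (Balpha alpha) = (ln (n%:R : R))%:C.
Proof.
have blocks_cvg : (fun J => J %/ n * n)%N @ \oo --> \oo.
  apply/cvgnyPge => A; near=> J.
  (* Rounding [J] down to a multiple of [n] loses less than [n]. *)
  have : (A + n <= J)%N by near: J; exact: nbhs_infty_ge.
  by rewrite [X in (_ <= X)%N](divn_eq J n); have := ltn_pmod J n_ge1; lia.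
have frakh_cvg : frakh_seq mu (Balpha alpha) @ \oo --> ((ln (n%:R : R))%:C : R[i]^o).
  rewrite (_ : frakh_seq _ _ = fun J =>
      (ln (n%:R : R) * series mu (J %/ n * n)%N)%:C : R[i]^o); last first.
    by apply/funext => J; exact: frakh_Balpha.
  apply: cvg_real_complex; rewrite -[X in _ --> X]mulr1; apply: cvgMr.
  exact: (cvg_comp _ _ blocks_cvg mu_sum1).
split; first by apply/cvg_ex; exists (ln n%:R)%:C.
exact: cvg_lim.
Unshelve. all: end_near.
Qed.
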